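(* Let $p>3$ be prime, $b,c\in\mathbb{Q}$, and assume $h(x)=x^{2p}+bx^p+c^p$ is irreducible over $\mathbb{Q}$. Let $\Delta=b^2-4c^p$ and fix a square root $\sqrt{\Delta}$. Working in a fixed algebraic closure of $\mathbb{Q}$, let $\alpha$ be a root of $x^2+bx+c^p$, choose $\beta$ with $\beta^p=\alpha$, put $\beta_1=c/\beta$, let $\zeta_p$ be a primitive $p$th root of unity, $F_p=\mathbb{Q}(\zeta_p)$, and let $K$ be the splitting field of $h$ over $\mathbb{Q}$. For $i\in\mathbb{Z}_p$ let $D_i=\mathbb{Q}(\zeta_p^i\beta+\zeta_p^{-i}\beta_1)$ and $\mathcal{D}=\{D_i\}_{i\in\mathbb{Z}_p}$. For $\sigma\in\mathrm{Gal}(K/\mathbb{Q})$ let $\epsilon_\sigma=\sigma(\sqrt{\Delta})/\sqrt{\Delta}\in\{\pm1\}$. If $\sqrt{\Delta}\notin F_p$, then $\sigma\mapsto(\sigma(D_0),\epsilon_\sigma,\sigma(\zeta_p))$ is a bijection from $\mathrm{Gal}(K/\mathbb{Q})$ onto $\mathcal{D}\times\{\pm1\}\times\{\zeta_p^i\}_{i\in\mathbb{Z}_p^\times}$. If $\sqrt{\Delta}\in F_p$, then $\sigma\mapsto(\sigma(D_0),\sigma(\zeta_p))$ is a bijection from $\mathrm{Gal}(K/\mathbb{Q})$ onto $\mathcal{D}\times\{\zeta_p^i\}_{i\in\mathbb{Z}_p^\times}$.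
   Context: The fields $D_i$, $i\in\mathbb{Z}_p$, are pairwise distinct, and each $\sigma\in\mathrm{Gal}(K/\mathbb{Q})$ maps each $D_i$ onto some $D_j$. *)

(* Defs.v *)
From HB Require Import structures.
From mathcomp Require Import all_boot all_order all_algebra all_fingroup all_field.
From mathcomp Require Import classical_sets functions.

Set Implicit Arguments.
Unset Strict Implicit.
Unset Printing Implicit Defensive.

Import GRing.Theory.
Local Open Scope ring_scope.

Definition hpoly (p : nat) (b c : rat) : {poly rat} :=
  'X^(2 * p) + b *: 'X^p + (c ^+ p)%:P.

Definition alpha_poly (p : nat) (b c : rat) : {poly rat} :=
  'X^2 + b *: 'X + (c ^+ p)%:P.

Definition Delta (p : nat) (b c : rat) : rat := b ^+ 2 - 4 * c ^+ p.

(* L stands for the ambient algebraic closure: the theory of 'Gal(K / k) needs a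
   finite normal extension of rat, and an arbitrary one is allowed as long as it
   contains the numbers at hand. *)
Section Fields.

Variables (p : nat) (L : splittingFieldType rat).

Definition Dfield (c : rat) (beta zeta : L) (i : 'Z_p) : {vspace L} :=
  let beta1 := c%:A / beta in
  <<1; zeta ^+ i * beta + zeta ^- i * beta1>>%VS.

Definition Dfamily (c : rat) (beta zeta : L) : set {vspace L} :=
  range (Dfield c beta zeta).

Definition primitive_powers (zeta : L) : set L :=
  [set zeta ^+ i | i in [set i : 'Z_p | i \is a GRing.unit]]%classic.

End Fields.

Arguments Dfield p {L}.
Arguments Dfamily p {L}.
Arguments primitive_powers p {L}.

Definition signs (L : splittingFieldType rat) : set L := [set 1; -1]%classic.
Arguments signs L : clear implicits.

(* The action of sigma : gal_of K is only meaningful on K, which contains D_0,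
   sqrtDelta and zeta whenever K is the splitting field of hpoly. *)
Definition epsilon (L : splittingFieldType rat) (K : {subfield L})
    (sqrtDelta : L) (sigma : gal_of K) : L :=
  sigma sqrtDelta / sqrtDelta.

(* Main.v *)
Require Import Defs.
From HB Require Import structures.
From mathcomp Require Import all_boot all_order all_algebra all_fingroup all_field.
From mathcomp Require Import classical_sets functions.
From mathcomp Require Import ring zify.

Import GRing.Theory.
Local Open Scope ring_scope.

(* Injectivity comes down to the fields D_i being distinct: an automorphism
   fixing zeta and sqrtDelta multiplies beta by some zeta^k, hence sends D_0 to
   D_k.  If D_i = D_j for some i <> j, translating by automorphisms shows that all
   the D_i are equal; writing r_i for the generator of D_i, the identity
   r_1 + r_{-1} = (zeta + zeta^-1) r_0 then puts zeta + zeta^-1 in D_0.  As D_0 has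
   degree p over Q, while zeta + zeta^-1 has degree (p - 1) / 2, this forces
   p <= 3.  Surjectivity is a count: p divides [K : Q] because beta has degree 2p,
   and p is prime to the degree p - 1 or 2(p - 1) of Q(zeta, sqrtDelta), so that
   Gal(K / Q) has at least as many elements as the target. *)

(** * General facts: counting, cyclotomic degree, endomorphisms of extensions *)

(** Pigeonhole with a list as target, since the codomain [L] will be infinite. The values of [f] on
    [A] are distinct members of [s], so once there are [size s] of them they exhaust [s]; only the
    length of [s] has to be computed. *)
Lemma inj_card_surj (aT : finType) (rT : eqType) (A : {set aT}) (f : aT -> rT)
    (s : seq rT) :
  {in A &, injective f} -> {in A, forall x, f x \in s} -> (size s <= #|A|)%N ->
  {in s, forall y, exists2 x, x \in A & f x = y}.
Proof.
move=> f_inj f_s le_sA y sy.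
have uf : uniq [seq f x | x <- enum A].
  by rewrite map_inj_in_uniq ?enum_uniq // => u v; rewrite !mem_enum; apply: f_inj.
have sub : {subset [seq f x | x <- enum A] <= s}.
  by move=> z /mapP[x]; rewrite mem_enum => /f_s fx_s ->.
have /(uniq_min_size uf sub)[_ eqs] : (size s <= size [seq f x | x <- enum A])%N.
  by rewrite size_map -cardE.
by move: sy; rewrite -eqs => /mapP[x]; rewrite mem_enum => Ax ->; exists x.
Qed.

(** The minimal polynomial comes from some [q] over [F] dividing [f]; its degree is positive, so
    irreducibility makes [q] an associate of [f]. *)
Lemma minPoly_irreducible (F : fieldType) (L : fieldExtType F) (f : {poly F})
    (x : L) :
  irreducible_poly f -> root (map_poly (in_alg L) f) x ->
  minPoly 1 x %= map_poly (in_alg L) f.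
Proof.
move=> [_ irr_f] fx0; have /polyOver1P[q Dq] := minPolyOver 1 x.
have f_over1: map_poly (in_alg L) f \is a polyOver 1%VS by apply/polyOver1P; exists f.
have := minPoly_dvdp f_over1 fx0; rewrite Dq dvdp_map => /irr_f.
rewrite eqp_map => -> //; rewrite -(size_map_poly (in_alg L)) -Dq size_minPoly eqSS -lt0n.
by rewrite adjoin_degreeE divn_gt0 ?adim_gt0 // dimvS ?subv_adjoin.
Qed.

(** Since [X^n - 1] is the product of the ['Phi_d] with [d] dividing [n], some ['Phi_d] vanishes at
    [z]. Then [z ^+ d = 1], and primitivity forces [d = n]. *)
Lemma root_Cyclotomic (R : idomainType) n (z : R) :
  n.-primitive_root z -> root (map_poly intr 'Phi_n) z.
Proof.
move=> prim_z; have n_gt0 := prim_order_gt0 prim_z.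
have root_Xn1 m x : root (map_poly intr ('X^m - 1) : {poly R}) x = (x ^+ m == 1).
  by rewrite rmorphB /= map_polyXn rmorph1 rootE !hornerE subr_eq0.
have : root (map_poly intr ('X^n - 1)) z by rewrite root_Xn1 prim_expr_order.
rewrite -prod_Cyclotomic // rmorph_prod -(big_map (fun d => map_poly intr 'Phi_d) predT id).
rewrite -[root _ _]negbK root_bigmul -has_predC => /hasP[_ /mapP[d dv_d ->] /negbNE rz].
move: dv_d; rewrite -dvdn_divisors // => dv_d.
suff -> : n = d by [].
have d_gt0 := dvdn_gt0 n_gt0 dv_d.
apply/eqP; rewrite eqn_dvd dv_d andbT (prim_order_dvd prim_z) -root_Xn1.
rewrite -prod_Cyclotomic // (big_rem d) -?dvdn_divisors //=.
by rewrite rmorphM /= rootM rz.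
Qed.

(** The minimal polynomial [q] of [z] divides ['Phi_n], which bounds its degree above. A root [y] of
    [q] in [algC] is then a primitive [n]th root of unity; its minimal polynomial over the rationals
    has degree [totient n] and divides [q], which gives the lower bound. *)
Lemma dim_cyclotomic_rat (L : fieldExtType rat) n (z : L) :
  n.-primitive_root z -> \dim <<1; z>> = totient n.
Proof.
move=> prim_z; have n_gt0 := prim_order_gt0 prim_z.
have /polyOver1P[q Dq] := minPolyOver 1 z.
have pZtoQtoR (R : unitRingType) (f : {rmorphism rat -> R}) (r : {poly int}) :
    map_poly f (map_poly intr r) = map_poly intr r.
  by rewrite -map_poly_comp; apply: eq_map_poly => k; rewrite /= rmorph_int.
have dv_q : q %| map_poly intr 'Phi_n.
  rewrite -(dvdp_map (in_alg L)) -Dq minPoly_dvdp //.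
    by apply/polyOver1P; exists (map_poly intr 'Phi_n).
  by rewrite pZtoQtoR root_Cyclotomic.
have dimE : \dim <<1; z>> = (size q).-1.
  by rewrite dim_Fadjoin dimv1 muln1 -(size_map_poly (in_alg L)) -Dq size_minPoly.
have q_gt1 : (1 < size q)%N.
  by rewrite -(size_map_poly (in_alg L)) -Dq size_minPoly ltnS adjoin_degreeE
    divn_gt0 ?adim_gt0 // dimvS ?subv_adjoin.
have [z0 prim_z0] := C_prim_root_exists n_gt0.
have [y qy0] : exists y, root (map_poly (@ratr algC) q) y.
  by apply/closed_rootP; rewrite size_map_poly neq_ltn q_gt1 orbT.
have prim_y : n.-primitive_root y.
  rewrite -(root_cyclotomic prim_z0) -(Cintr_Cyclotomic prim_z0).
  by rewrite -(pZtoQtoR _ (@ratr algC)) (root_dvdp _ qy0) // dvdp_map.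
have [f [Df _] dv_f] := minCpolyP y.
have size_f : size f = (totient n).+1.
  by rewrite -(size_map_poly (@ratr algC)) -Df (minCpoly_cyclotomic prim_y) size_cyclotomic.
have Phi0 : map_poly intr 'Phi_n != 0 :> {poly rat}.
  by rewrite monic_neq0 // monic_map // Cyclotomic_monic.
have size_Phi : size (map_poly intr 'Phi_n : {poly rat}) = (totient n).+1.
  by rewrite size_map_inj_poly ?size_Cyclotomic //; apply: intr_inj.
suff size_q : size q = (totient n).+1 by rewrite dimE size_q.
apply/eqP; rewrite eqn_leq -{1}size_Phi -size_f !dvdp_leq //.
  by rewrite (dvdpN0 dv_q).
by rewrite -dv_f.
Qed.

Lemma adjoin_degree_leq2 {F : fieldType} {L : fieldExtType F} (M : {subfield L})
    (x y : L) :
  x + y \in M -> x * y \in M -> (adjoin_degree M x <= 2)%N.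
Proof.
move=> xDy xMy; pose f := ('X - x%:P) * ('X - y%:P).
have size_f : size f = 3 by rewrite size_mul ?polyXsubC_eq0 ?size_XsubC.
have fM : f \is a polyOver M.
  have -> : f = 'X^2 - (x + y)%:P * 'X + (x * y)%:P by rewrite polyCD polyCM /f; ring.
  by rewrite rpredD ?rpredB ?rpredM ?polyOverC ?rpredX ?polyOverX.
suff : (size (minPoly M x) <= size f)%N by rewrite size_minPoly size_f ltnS.
rewrite dvdp_leq -?size_poly_eq0 ?size_f //.
by rewrite minPoly_dvdp // rootE !hornerE subrr mul0r.
Qed.

Lemma dim_Fadjoin_leq {F : fieldType} {L : fieldExtType F} (M : {subfield L})
    (x : L) (f : {poly L}) :
  f \is a polyOver M -> f != 0 -> root f x ->
  (\dim <<M; x>> <= (size f).-1 * \dim M)%N.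
Proof.
move=> fE f0 fx; rewrite dim_Fadjoin leq_mul2r; apply/orP; right.
by rewrite -ltnS -size_minPoly prednK ?lt0n ?size_poly_eq0 // dvdp_leq ?minPoly_dvdp.
Qed.

Lemma ahom_scalar {F : fieldType} {L : fieldExtType F} (s : 'AEnd(L)) (k : F) : s k%:A = k%:A.
Proof. by rewrite linearZ rmorph1. Qed.

Lemma ahom_adjoin1 {F : fieldType} {L : fieldExtType F} (s : 'AEnd(L))
    (x : L) : (s @: <<1; x>>)%VS = <<1; s x>>%VS.
Proof. by rewrite aimg_adjoin aimg1. Qed.

(** The elements on which two endomorphisms agree form a subfield, so agreement on a generator is
    enough. *)
Lemma ahom_eq_adjoin {F : fieldType} {L : fieldExtType F} (s t : 'AEnd(L))
    (x y : L) :
  s x = t x -> y \in <<1; x>>%VS -> s y = t y.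
Proof.
move=> sx; have /subvP sub : (<<1; x>> <= lker (ahval s - ahval t))%VS.
  by apply/FadjoinP; split; [exact: sub1v | apply/eqlfunP].
by move/sub/eqlfunP.
Qed.

Lemma prime_prim_root {R : idomainType} {p : nat} (v : R) :
  prime p -> v ^+ p = 1 -> v != 1 -> p.-primitive_root v.
Proof.
move=> p_prime vp v1; have [m prim_v dv_m] := prim_order_exists (prime_gt0 p_prime) vp.
have /primeP[_ /(_ _ dv_m)/pred2P[m1 | <- //]] := p_prime.
by case/negP: v1; rewrite -(expr1 v) -m1 prim_expr_order.
Qed.

Lemma Zp_unit_prime {p : nat} (i : 'Z_p) :
  prime p -> (i \is a GRing.unit) = (i != 0).
Proof.
move=> p_prime; apply/idP/idP => [|i0]; first by apply: contraTneq => ->; rewrite unitr0.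
rewrite -(natr_Zp i) unitZpE ?prime_gt1 // prime_coprime // gtnNdvd ?lt0n //.
by rewrite -[X in (_ < X)%N](Zp_cast (prime_gt1 p_prime)).
Qed.

Lemma card_Zp_prime {p : nat} : prime p -> #|'Z_p| = p.
Proof. by move=> p_prime; rewrite card_ord Zp_cast ?prime_gt1. Qed.

(** * The roots of [hpoly] and the relations between [alpha], [beta], [sqrtDelta] *)

Section DicksonGalois.

Variables (p : nat) (b c : rat) (L : splittingFieldType rat) (K : {subfield L}).
Variables (sqrtDelta alpha beta zeta : L).
Hypothesis p_prime : prime p.
Hypothesis p_gt3 : (3 < p)%N.
Hypothesis h_irr : irreducible_poly (hpoly p b c).
Hypothesis sqrtDeltaP : sqrtDelta ^+ 2 = (Delta p b c)%:A.
Hypothesis alpha_root : root (map_poly (in_alg L) (alpha_poly p b c)) alpha.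
Hypothesis betaP : beta ^+ p = alpha.
Hypothesis zeta_prim : p.-primitive_root zeta.
Hypothesis K_split : splittingFieldFor 1 (map_poly (in_alg L) (hpoly p b c)) K.

Local Notation beta1 := (c%:A / beta).
(** The generators and their fields are indexed by [p]th roots of unity rather than by exponents:
    for [w = zeta ^+ i], [D w] is the field $D_i$, and [D 1] is $D_0$. *)
Local Notation r w := (w * beta + w^-1 * beta1).
Local Notation D w := <<1; r w>>%VS.
Local Notation hL := (map_poly (in_alg L) (hpoly p b c)).
Local Notation E := <<<<1; zeta>>; sqrtDelta>>%AS.

Lemma p_gt0 : (0 < p)%N. Proof. exact: prime_gt0. Qed.

Lemma horner_hpoly x :
  hL.[x] = (x ^+ p) ^+ 2 + b%:A * x ^+ p + c%:A ^+ p.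
Proof.
rewrite /hpoly !rmorphD /= map_polyZ !map_polyXn map_polyC /= !hornerE.
by rewrite mulnC exprM -!in_algE rmorphXn.
Qed.

Lemma alphaE : alpha ^+ 2 + b%:A * alpha + c%:A ^+ p = 0.
Proof.
have /rootP := alpha_root; rewrite /alpha_poly !rmorphD /= map_polyZ map_polyXn map_polyX map_polyC /= !hornerE.
by rewrite -!in_algE rmorphXn.
Qed.

Lemma root_beta : root hL beta.
Proof. by rewrite rootE horner_hpoly betaP alphaE. Qed.

Lemma size_hpoly : size hL = (2 * p).+1.
Proof.
rewrite size_map_poly /hpoly -addrA size_polyDl size_polyXn //.
rewrite (leq_ltn_trans (size_polyD _ _)) // ltnS geq_max; apply/andP; split.
  by rewrite (leq_trans (size_scale_leq _ _)) // size_polyXn; lia.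
by rewrite (leq_trans (size_polyC_leq1 _)); lia.
Qed.

Lemma minPoly_beta : minPoly 1 beta %= hL.
Proof. exact: minPoly_irreducible h_irr root_beta. Qed.

Lemma dim_beta : \dim <<1; beta>> = (2 * p)%N.
Proof.
have := eqp_size minPoly_beta; rewrite size_minPoly size_hpoly => -[].
by rewrite dim_Fadjoin dimv1 muln1.
Qed.

(** Otherwise [beta], a root of $X^p - \alpha$, would have degree at most [p] instead of [2 * p]. *)
Lemma alpha_irrational : alpha \notin 1%VS.
Proof.
apply/negP => a1.
have := dim_Fadjoin_leq 1 beta ('X^p - alpha%:P).
rewrite dim_beta dimv1 muln1 size_XnsubC ?p_gt0 // => /(_ _ _ _)/wrap[].
- by rewrite rpredB ?polyOverC ?rpredX ?polyOverX.
- by rewrite -size_poly_eq0 size_XnsubC ?p_gt0.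
- by rewrite rootE !hornerE betaP subrr.
- lia.
Qed.

Lemma alpha_neq0 : alpha != 0.
Proof. by apply: contraNneq alpha_irrational => ->; rewrite mem0v. Qed.

Lemma beta_neq0 : beta != 0.
Proof. by apply: contraNneq alpha_neq0 => b0; rewrite -betaP b0 expr0n gtn_eqF ?p_gt0. Qed.

Lemma c_neq0 : c%:A != 0 :> L.
Proof.
apply: contraNneq alpha_irrational => c0; have := alphaE.
rewrite c0 expr0n gtn_eqF ?p_gt0 // addr0 expr2 -mulrDl => /eqP.
rewrite mulf_eq0 (negPf alpha_neq0) orbF addr_eq0 => /eqP->.
by rewrite rpredN rpredZ ?mem1v.
Qed.

Lemma beta1_neq0 : beta1 != 0.
Proof. by rewrite mulf_neq0 ?invr_eq0 ?c_neq0 ?beta_neq0. Qed.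

(** The right-hand side is the second root of $x^2 + bx + c^p$, and the product of the two roots is
    $c^p = \alpha\beta_1^p$. *)
Lemma beta1P : beta1 ^+ p = - b%:A - alpha.
Proof.
have a0 := alpha_neq0; rewrite expr_div_n betaP; apply: (mulIf a0).
by rewrite divfK //; apply/eqP; rewrite -subr_eq0 -alphaE; apply/eqP; ring.
Qed.

Lemma sqrtDelta_alpha :
  sqrtDelta = 2 * alpha + b%:A \/ sqrtDelta = - (2 * alpha + b%:A).
Proof.
have : sqrtDelta ^+ 2 == (2 * alpha + b%:A) ^+ 2.
  rewrite sqrtDeltaP /Delta -in_algE rmorphB rmorphXn rmorphM rmorphXn rmorph_nat /=.
  (* The difference of the two squares is -4 times the left-hand side of [alphaE]. *)
  by rewrite -subr_eq0 -(mulr0 (- 4)) -alphaE; apply/eqP; ring.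
by rewrite eqf_sqr => /orP[] /eqP; [left | right].
Qed.

Lemma two_neq0 : 2 != 0 :> L.
Proof. by rewrite -(rmorph_nat (in_alg L)) fmorph_eq0. Qed.

Lemma sqrtDelta_neq0 : sqrtDelta != 0.
Proof.
apply: contraNneq alpha_irrational => d0.
have /eqP : 2 * alpha + b%:A = 0.
  by case: sqrtDelta_alpha; rewrite d0 => /esym/eqP; rewrite ?oppr_eq0 => /eqP.
rewrite addr_eq0 => /eqP a2; rewrite -(mulKf two_neq0 alpha) a2.
by rewrite rpredM ?rpredV ?rpredN ?rpredZ ?rpred_nat ?mem1v.
Qed.

(** Hence an automorphism fixing [sqrtDelta] fixes [alpha], and so multiplies [beta] by a [p]th root
    of unity. *)
Lemma alpha_sqrtDelta : alpha \in <<1; sqrtDelta>>%VS.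
Proof.
have d_in : sqrtDelta \in <<1; sqrtDelta>>%VS by rewrite memv_adjoin.
have b_in : b%:A \in <<1; sqrtDelta>>%VS by rewrite rpredZ ?mem1v.
rewrite -(mulKf two_neq0 alpha) rpredM ?rpredV ?rpred_nat //.
rewrite -(addrK b%:A (2 * alpha)) rpredB //.
by case: sqrtDelta_alpha => [<- // | dE]; rewrite -(opprK (2 * alpha + _)) rpredN -dE.
Qed.

Lemma unity_ratio (x y : L) : y != 0 -> x ^+ p = y ^+ p ->
  exists2 w, w ^+ p = 1 & x = w * y.
Proof.
move=> y0 xy; exists (x / y); last by rewrite divfK.
by rewrite expr_div_n xy divff ?expf_neq0.
Qed.

Lemma unity_zeta (w : L) : w ^+ p = 1 -> exists n : nat, w = zeta ^+ n.
Proof. by case/(prim_rootP zeta_prim) => i ->; exists i. Qed.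

Lemma hpoly_roots (x : L) : root hL x ->
  exists2 w, w ^+ p = 1 & x = w * beta \/ x = w * beta1.
Proof.
rewrite rootE horner_hpoly => /eqP hx.
(* This is the factorization of $h$ as a quadratic in $x^p$, whose roots are $\alpha = \beta^p$ and
   $-b-\alpha = \beta_1^p$. *)
have : (x ^+ p - alpha) * (x ^+ p - (- b%:A - alpha)) == 0.
  rewrite -(subrr (0 : L)) -{1}hx -alphaE; apply/eqP; ring.
rewrite mulf_eq0 !subr_eq0 -{1}betaP -beta1P.
case/orP=> /eqP/unity_ratio-[]; rewrite ?beta_neq0 ?beta1_neq0 // => w w1 ->.
  by exists w; last left.
by exists w; last right.
Qed.

Lemma root_unity_beta w : w ^+ p = 1 -> root hL (w * beta).
Proof. by move=> w1; rewrite rootE horner_hpoly exprMn w1 mul1r betaP alphaE. Qed.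

Lemma root_unity_beta1 w : w ^+ p = 1 -> root hL (w * beta1).
Proof.
move=> w1; rewrite rootE horner_hpoly exprMn w1 mul1r beta1P -alphaE.
by apply/eqP; ring.
Qed.

(** * The splitting field [K], its subfield [E], and their degrees *)

Lemma root_hpoly_memK x : root hL x -> x \in K.
Proof.
have [rs Dh <-] := K_split; rewrite (eqp_root Dh) root_prod_XsubC.
exact: seqv_sub_adjoin.
Qed.

Lemma betaK : beta \in K.
Proof. by rewrite -(mul1r beta) root_hpoly_memK ?root_unity_beta ?expr1n. Qed.

(** Both [w * beta] and [beta] are roots of $h$, and [w] is their quotient. *)
Lemma unityK (w : L) : w ^+ p = 1 -> w \in K.
Proof.
move=> w1; rewrite -(mulfK beta_neq0 w) rpred_div ?betaK //.
by rewrite root_hpoly_memK ?root_unity_beta.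
Qed.

Lemma zetaK : zeta \in K.
Proof. by rewrite unityK ?prim_expr_order. Qed.

Lemma sqrtDeltaK : sqrtDelta \in K.
Proof.
have aK : 2 * alpha + b%:A \in K.
  by rewrite rpredD ?rpredM ?rpred_nat ?rpredZ ?mem1v // -betaP rpredX ?betaK.
by case: sqrtDelta_alpha => ->; rewrite ?rpredN.
Qed.

Lemma rK (w : L) : w ^+ p = 1 -> r w \in K.
Proof.
move=> w1; have wK := unityK w w1.
by rewrite rpredD ?rpredM ?rpredV ?betaK ?rpredZ ?mem1v.
Qed.

Lemma subK (M : {subfield L}) : zeta \in M -> beta \in M -> (K <= M)%VS.
Proof.
move=> zM bM; have [rs Dh <-] := K_split.
apply/(@Fadjoin_seqP _ _ 1%AS); split=> [|x]; first exact: sub1v.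
rewrite -root_prod_XsubC -(eqp_root Dh) => /hpoly_roots[w /unity_zeta[n ->]].
by case=> ->; rewrite rpredM ?rpredX ?rpredV ?rpredZ ?mem1v // rpredM ?rpredV ?rpredZ ?mem1v.
Qed.

Lemma galoisK : galois 1 K.
Proof.
apply/and3P; split; first exact: sub1v.
  apply/separableP => y _; apply: pcharf0_separable => q.
  by rewrite (fmorph_pchar (in_alg L)) Num.Theory.pchar_num.
apply/splitting_normalField; first exact: sub1v.
by exists hL => //; apply/polyOver1P; exists (hpoly p b c).
Qed.

Lemma dim_zeta : \dim <<1; zeta>> = p.-1.
Proof. by rewrite (dim_cyclotomic_rat _ _ _ zeta_prim) totient_prime. Qed.

(** The boolean is read as 0 or 1, so the first factor is 2 when [sqrtDelta] lies outside $F_p$ and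
    1 otherwise; both cases of the theorem share this formula. *)
Lemma dim_E : \dim E = ((sqrtDelta \notin <<1; zeta>>%VS).+1 * p.-1)%N.
Proof.
case: (boolP (sqrtDelta \in <<1; zeta>>%VS)) => [/Fadjoin_idP Ez | nd].
  by rewrite mul1n -dim_zeta; apply: (congr1 (fun V : {vspace L} => \dim V) Ez).
rewrite dim_Fadjoin dim_zeta; congr (_ * _)%N; apply/eqP; rewrite eqn_leq; apply/andP; split.
  apply: (adjoin_degree_leq2 _ _ (- sqrtDelta)); first by rewrite subrr rpred0.
  by rewrite mulrN -expr2 sqrtDeltaP rpredN rpredZ ?mem1v.
have : adjoin_degree <<1; zeta>> sqrtDelta != 1%N by rewrite adjoin_deg_eq1.
have : (0 < adjoin_degree <<1; zeta>> sqrtDelta)%N.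
  by rewrite adjoin_degreeE divn_gt0 ?adim_gt0 // dimvS ?subv_adjoin.
by case: (adjoin_degree _ _) => [|[]].
Qed.

Lemma subEK : (E <= K)%VS.
Proof.
apply/FadjoinP; split; last exact: sqrtDeltaK.
by apply/FadjoinP; split; [exact: sub1v | exact: zetaK].
Qed.

Lemma coprime_p_dim_E : coprime p (\dim E).
Proof.
have ndvd : ~~ (p %| p.-1)%N by rewrite gtnNdvd //; lia.
rewrite prime_coprime // dim_E Euclid_dvdM // negb_or ndvd andbT gtnNdvd //.
by case: (sqrtDelta \notin <<1; zeta>>%VS); lia.
Qed.

(** The coprime numbers [p] and [\dim E] each divide [\dim K], through [<<1; beta>>] and [E]. This
    serves both to bound the Galois group from below and to show that [K] is strictly larger than
    [E]. *)
Lemma dvdn_dimK : (p * \dim E %| \dim K)%N.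
Proof.
rewrite Gauss_dvd ?coprime_p_dim_E // field_dimS ?subEK // andbT.
have : (<<1; beta>> <= K)%VS by apply/FadjoinP; split; [exact: sub1v | exact: betaK].
by move/field_dimS; rewrite dim_beta; apply: dvdn_trans; rewrite dvdn_mull.
Qed.

Lemma card_galK : (p * \dim E <= #|'Gal(K / 1)%g|)%N.
Proof. by rewrite -(galois_dim galoisK) dimv1 divn1 dvdn_leq ?adim_gt0 ?dvdn_dimK. Qed.

(** * Action of automorphisms on the roots and on the generators [r w] *)

Lemma ahom_root (s : 'AEnd(L)) (x : L) : root hL x -> root hL (s x).
Proof.
rewrite !rootE !horner_hpoly => /eqP/(congr1 s); rewrite rmorph0 => /eqP.
by rewrite !rmorphD !rmorphXn rmorphM !rmorphXn /= !ahom_scalar.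
Qed.

Lemma gal_eq (s t : gal_of K) : s zeta = t zeta -> s beta = t beta -> s = t.
Proof.
move=> sz sb; apply/eqP/gal_eqP => x.
have /subvP sub : (K <= lker (ahval s - ahval t))%VS.
  by apply: subK; apply/eqlfunP.
by move/sub/eqlfunP.
Qed.

(** Scaling [beta] by [u] scales [beta1], which is $c/\beta$, by [u^-1]. *)
Lemma ahom_r (s : 'AEnd(L)) (u w : L) :
  s beta = u * beta -> s w = w -> s (r w) = r (w * u).
Proof.
move=> sb sw; rewrite rmorphD !rmorphM !fmorphV /= sb sw ahom_scalar !invfM; ring.
Qed.

Lemma ahom_r1 (s : 'AEnd(L)) : exists2 w : L, w ^+ p = 1 & s (r 1) = r w.
Proof.
have := ahom_root s _ root_beta => /hpoly_roots[w w1 sb].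
have [b0 w0 c0] : [/\ beta != 0, w != 0 & c%:A != 0 :> L].
  rewrite beta_neq0 c_neq0; split=> //.
  by apply: contra_eq_neq w1 => ->; rewrite expr0n gtn_eqF ?p_gt0 // eq_sym oner_eq0.
rewrite !mul1r invr1 rmorphD !rmorphM !fmorphV rmorph1 /= ahom_scalar mul1r.
move: sb c0; move: (c%:A : L) => d sb d0.
(* If [s beta = w * beta1], then [s beta1 = w^-1 * beta]: the two summands are exchanged and the
   index becomes [w^-1]. *)
case: sb => ->; [exists w => // | exists w^-1; first by rewrite exprVn w1 invr1].
  by field; rewrite b0 w0.
by field; rewrite b0 w0 d0 oner_neq0.
Qed.

Lemma fix_unity (s : 'AEnd(L)) (w : L) : s zeta = zeta -> w ^+ p = 1 -> s w = w.
Proof. by move=> sz /unity_zeta[n ->]; rewrite rmorphXn /= sz. Qed.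

Lemma gal_scale_beta (s : gal_of K) :
  s alpha = alpha -> exists2 w : L, w ^+ p = 1 & s beta = w * beta.
Proof.
by move=> sa; apply: unity_ratio; rewrite ?beta_neq0 // -rmorphXn /= betaP.
Qed.

Lemma galX_beta (s : gal_of K) (w : L) n : s zeta = zeta -> w ^+ p = 1 ->
  s beta = w * beta -> (s ^+ n)%g beta = w ^+ n * beta.
Proof.
move=> sz w1 sb; elim: n => [|n IHn]; first by rewrite expg0 gal_id expr0 mul1r.
rewrite expgSr galM ?betaK // IHn rmorphM /= sb fix_unity //.
  by rewrite exprSr mulrA.
by rewrite exprAC w1 expr1n.
Qed.

(* [K] is strictly larger than [E], and a nontrivial element of ['Gal(K / E)]
   multiplies [beta] by a primitive root of unity. *)
Lemma exists_scale_beta (u : L) : u ^+ p = 1 ->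
  exists s : gal_of K, s zeta = zeta /\ s beta = u * beta.
Proof.
move=> up; have galKE : galois E K by rewrite (galoisS _ galoisK) // sub1v subEK.
have /trivgPn[s sE s1] : 'Gal(K / E)%g != 1%g.
  rewrite -cardG_gt1 -(galois_dim galKE) ltn_divRL ?field_dimS ?subEK // mul1n.
  have := dvdn_leq (adim_gt0 K) dvdn_dimK.
  by apply: leq_trans; rewrite ltn_Pmull ?adim_gt0 // prime_gt1.
have fixE x : x \in E -> s x = x by apply: fixed_gal; rewrite ?subEK.
have sz : s zeta = zeta by rewrite fixE // (subvP (subv_adjoin _ _)) ?memv_adjoin.
have sa : s alpha = alpha.
  rewrite fixE //; apply: (subvP _ _ alpha_sqrtDelta).
  by apply/FadjoinP; split; [exact: sub1v | exact: memv_adjoin].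
have [v vp sb] := gal_scale_beta s sa.
have v1 : v != 1.
  apply: contraNneq s1 => v1; apply/eqP/gal_eq; first by rewrite sz gal_id.
  by rewrite sb v1 mul1r gal_id.
(* A nontrivial [p]th root of unity [v] is primitive, so [u] is a power of [v] and the same power of
   [s] scales [beta] by [u]. *)
have [n ->] := prim_rootP (prime_prim_root _ p_prime vp v1) up.
exists (s ^+ n)%g; split; last exact: galX_beta.
elim: (n : nat) => [|m IHm]; first by rewrite expg0 gal_id.
by rewrite expgSr galM ?zetaK // IHm.
Qed.

(** * The degree of [D 1] and the distinctness of the fields *)

(** Equality would give $\alpha = -b-\alpha$ on taking [p]th powers, so [alpha] would be
    rational. *)
Lemma beta_neq_beta1 : beta != beta1.
Proof.
apply: contraNneq alpha_irrational => bb; have := beta1P; rewrite -bb betaP => aE.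
have {}aE : 2 * alpha = - b%:A by rewrite mulr_natl mulr2n {1}aE subrK.
rewrite -(mulKf two_neq0 alpha) aE.
by rewrite rpredM ?rpredV ?rpredN ?rpredZ ?rpred_nat ?mem1v.
Qed.

Lemma r1E : r 1 = beta + beta1.
Proof. by rewrite invr1 !mul1r. Qed.

(* The automorphism exchanging [beta] and [beta1] fixes [D 1] pointwise. *)
Lemma beta_notin_D1 : beta \notin D 1.
Proof.
(* As $h$ is irreducible, [beta1] is a conjugate of [beta], and normality of [K] provides the
   exchanging automorphism. *)
have rb1 : root (minPoly 1 beta) beta1.
  by rewrite (eqp_root minPoly_beta) -(mul1r beta1) root_unity_beta1 ?expr1n.
have [_ _ nK] := and3P galoisK.
have [s _ sb] := normalField_root_minPoly (sub1v K) nK betaK rb1.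
apply/negP => bD; have := beta_neq_beta1; rewrite -sb eq_sym => /eqP[].
rewrite -[RHS](gal_id K beta); apply: ahom_eq_adjoin bD; rewrite gal_id r1E.
rewrite rmorphD rmorphM fmorphV /= ahom_scalar sb addrC invf_div mulrC divfK //.
exact: c_neq0.
Qed.

(** Over [D 1], [beta] is a root of $X^2 - (\beta+\beta_1)X + c$ but does not lie in [D 1]; so
    [<<1; beta>>], of degree [2 * p], is quadratic over [D 1]. *)
Lemma dim_D1 : \dim (D 1) = p.
Proof.
have bE : (<<1; beta>> = <<D 1; beta>>)%VS.
  apply/eqP; rewrite eqEsubv; apply/andP; split.
    by apply/FadjoinP; split; [exact: sub1v | exact: memv_adjoin].
  apply/FadjoinP; split; last exact: memv_adjoin.
  apply/FadjoinP; split; first exact: sub1v.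
  by rewrite r1E rpredD ?rpred_div ?rpredZ ?mem1v ?memv_adjoin.
have := dim_beta; rewrite bE dim_Fadjoin.
have : (adjoin_degree <<1; r 1>> beta <= 2)%N.
  apply: (adjoin_degree_leq2 _ _ beta1); first by rewrite -r1E memv_adjoin.
  by rewrite mulrC divfK ?beta_neq0 ?rpredZ ?mem1v.
have : adjoin_degree <<1; r 1>> beta != 1%N by rewrite adjoin_deg_eq1 beta_notin_D1.
case: (adjoin_degree _ _) => [|[|[|n]]] // _ _ /eqP.
  by rewrite eq_sym muln_eq0 /= gtn_eqF ?p_gt0.
by rewrite eqn_pmul2l // => /eqP.
Qed.

(** Otherwise the degree of [T] would divide both [p] and [p.-1], so [T] would be the rationals; as
    [zeta] is at most quadratic over [T], this gives $p - 1 \le 2$. *)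
Lemma zetaDV_notin_D1 : zeta + zeta^-1 \notin D 1.
Proof.
apply/negP => tD; pose T := <<1; zeta + zeta^-1>>%AS.
have z_in : zeta \in <<1; zeta>>%VS by exact: memv_adjoin.
have dvp : (\dim T %| p)%N.
  by rewrite -dim_D1 field_dimS //; apply/FadjoinP; split; first exact: sub1v.
have dvp1 : (\dim T %| p.-1)%N.
  rewrite -dim_zeta field_dimS //; apply/FadjoinP; split; first exact: sub1v.
  by rewrite rpredD ?rpredV.
have T1 : \dim T = 1%N.
  by apply/eqP; rewrite -dvdn1; have /eqP <- := coprimenP p_gt0; rewrite dvdn_gcd dvp dvp1.
have : (<<1; zeta>> <= <<T; zeta>>)%VS.
  by apply/FadjoinP; split; [exact: sub1v | exact: memv_adjoin].
move/dimvS; rewrite dim_zeta dim_Fadjoin T1 muln1.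
have : (adjoin_degree T zeta <= 2)%N.
  apply: (adjoin_degree_leq2 _ _ zeta^-1); first exact: memv_adjoin.
  by rewrite divff ?mem1v // (prim_root_eq0 zeta_prim) gtn_eqF ?p_gt0.
by move=> d2 /leq_trans/(_ d2); lia.
Qed.

(* If two of the fields agree, then by translating with a suitable automorphism
   all of them agree, so that [D 1] contains both [r 1] and
   [r zeta + r zeta^-1 = (zeta + zeta^-1) * r 1]. *)
Lemma D_inj (w v : L) : w ^+ p = 1 -> v ^+ p = 1 -> D w = D v -> w = v.
Proof.
move=> wp vp Dwv; apply/eqP/negPn/negP => wv.
have w0 : w != 0.
  by apply: contra_eq_neq wp => ->; rewrite expr0n gtn_eqF ?p_gt0 // eq_sym oner_eq0.
have wK y : w * (y / w) = y by rewrite mulrCA divff ?mulr1.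
have up : (v / w) ^+ p = 1 by rewrite expr_div_n wp vp divr1.
have u1 : v / w != 1 by rewrite -(inj_eq (mulIf w0)) divfK // mul1r eq_sym.
have [s [sz sb]] := exists_scale_beta _ up.
have step x : x ^+ p = 1 -> (s @: D x)%VS = D (x * (v / w)).
  by move=> xp; rewrite ahom_adjoin1 (ahom_r _ _ _ sb) // fix_unity.
(* Applying [s] to [D (w * (v / w) ^+ n) = D w] yields [D v] on the right, which is [D w] again by
   assumption. *)
have Du n : D (w * (v / w) ^+ n) = D w.
  elim: n => [|n IHn]; first by rewrite expr0 mulr1.
  rewrite exprSr mulrA -step ?IHn; last by rewrite exprMn wp exprAC up expr1n mulr1.
  by rewrite step // wK.
(* Being nontrivial, [v / w] generates all [p]th roots of unity, so its powers reach every
   [x / w]. *)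
have Dall x : x ^+ p = 1 -> D x = D w.
  move=> xp; have xwp : (x / w) ^+ p = 1 by rewrite expr_div_n wp xp divr1.
  have [n xE] := prim_rootP (prime_prim_root _ p_prime up u1) xwp.
  by rewrite -(Du n) -xE wK.
have zp : zeta ^+ p = 1 by rewrite prim_expr_order.
have r_in x : x ^+ p = 1 -> r x \in D 1.
  by move=> xp; rewrite (Dall 1) ?expr1n // -(Dall x) // memv_adjoin.
(* If [r 1] vanished, [D 1] would have degree 1 rather than [p]. *)
have r1_neq0 : r 1 != 0.
  apply: contra_eq_neq dim_D1 => ->; rewrite (Fadjoin0 1) dimv1.
  by apply: contraTneq p_prime => <-.
case/negP: zetaDV_notin_D1; rewrite -(mulfK r1_neq0 (zeta + _)) rpred_div ?r_in ?expr1n //.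
have -> : (zeta + zeta^-1) * r 1 = r zeta + r zeta^-1 by rewrite invr1 invrK; ring.
by rewrite rpredD ?r_in // exprVn zp invr1.
Qed.

(** * Injectivity, and the values taken by the components of the maps *)

Lemma gal_inj (s t : gal_of K) : (s @: D 1 = t @: D 1)%VS ->
  s sqrtDelta = t sqrtDelta -> s zeta = t zeta -> s = t.
Proof.
move=> sD sd sz; pose g := (s * t^-1)%g.
have gE x : x \in K -> g x = t^-1%g (s x) by move=> xK; rewrite galM.
have tK x : x \in K -> t^-1%g (t x) = x by move=> xK; rewrite -galM // mulgV gal_id.
have gz : g zeta = zeta by rewrite gE ?zetaK // sz tK ?zetaK.
have gd : g sqrtDelta = sqrtDelta by rewrite gE ?sqrtDeltaK // sd tK ?sqrtDeltaK.
have ga : g alpha = alpha.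
  by rewrite -[RHS](gal_id K alpha); apply: ahom_eq_adjoin alpha_sqrtDelta; rewrite gal_id.
have [w wp gb] := gal_scale_beta g ga.
have r1K : r 1 \in K by rewrite rK ?expr1n.
(* Here [g] sends [D 1] to [D w], but also to itself because [s] and [t] agree on [D 1] as a field;
   distinctness of the fields concludes. *)
have w1 : w = 1.
  apply: D_inj; rewrite ?expr1n //.
  rewrite -[w in LHS]mul1r -(ahom_r _ _ _ gb) ?rmorph1 // gE // -ahom_adjoin1 -ahom_adjoin1.
  by rewrite sD !ahom_adjoin1 tK.
apply/eqP; rewrite eq_mulgV1; apply/eqP/gal_eq; first by rewrite gal_id.
by rewrite gal_id -/g gb w1 mul1r.
Qed.

Lemma gal_D1 (s : gal_of K) : exists2 w : L, w ^+ p = 1 & (s @: D 1)%VS = D w.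
Proof. by have [w wp sr] := ahom_r1 s; exists w; rewrite // ahom_adjoin1 sr. Qed.

Lemma epsilon_sign (s : gal_of K) :
  epsilon sqrtDelta s = 1 \/ epsilon sqrtDelta s = - 1.
Proof.
have d0 := sqrtDelta_neq0; rewrite /epsilon.
have : s sqrtDelta ^+ 2 == sqrtDelta ^+ 2.
  by rewrite -rmorphXn /= sqrtDeltaP ahom_scalar.
by rewrite eqf_sqr => /orP[] /eqP->; [left | right]; rewrite ?mulNr divff.
Qed.

Lemma unity_Zp (w : L) : w ^+ p = 1 -> exists i : 'Z_p, w = zeta ^+ i.
Proof.
case/(prim_rootP zeta_prim) => i ->; exists (inZp i).
by rewrite /= Zp_cast ?prime_gt1 // prim_expr_mod.
Qed.

Lemma gal_zeta (s : gal_of K) : exists2 i : 'Z_p, i != 0 & s zeta = zeta ^+ i.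
Proof.
have [|i si] := unity_Zp (s zeta).
  by rewrite -rmorphXn /= prim_expr_order ?rmorph1.
exists i => //; apply: contra_eq_neq si => -> /=; rewrite fmorph_eq1.
by rewrite -(expr1 zeta) -(prim_order_dvd zeta_prim) gtnNdvd // prime_gt1.
Qed.

Lemma gal_Dfield (s : gal_of K) :
  exists i : 'Z_p, (s @: Dfield p c beta zeta 0%R)%VS = Dfield p c beta zeta i.
Proof. by have [w /unity_Zp[i ->] sD] := gal_D1 s; exists i. Qed.

(** * Counting the targets and the two bijections *)

Lemma size_Dfields : size [seq Dfield p c beta zeta i | i : 'Z_p] = p.
Proof. by rewrite size_image card_Zp_prime. Qed.

Lemma size_prim_powers : size [seq zeta ^+ i | i : 'Z_p in predC1 0] = p.-1.
Proof. by rewrite size_image cardC1 card_Zp_prime. Qed.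

Lemma set_bij_notin_Fp : sqrtDelta \notin <<1; zeta>>%VS ->
  set_bij [set` 'Gal(K / 1)%g]%classic
    (Dfamily p c beta zeta `*` signs L `*` primitive_powers p zeta)%classic
    (fun s : gal_of K =>
       ((s @: Dfield p c beta zeta 0%R)%VS, epsilon sqrtDelta s, s zeta)).
Proof.
move=> nd.
have f_inj : {in 'Gal(K / 1)%g &, injective (fun s : gal_of K =>
    ((s @: Dfield p c beta zeta 0%R)%VS, epsilon sqrtDelta s, s zeta))}.
  move=> s t _ _ [sD /(divIf sqrtDelta_neq0) sd sz]; exact: gal_inj.
(* A list covering the target set, of length [p * 2 * p.-1], which is exactly the lower bound
   [p * \dim E] for the Galois group. *)
pose tgt := [seq (De, z) | De <- [seq (V, e) | V <- [seq Dfield p c beta zeta i | i : 'Z_p],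
  e <- [:: 1; - 1 : L]], z <- [seq zeta ^+ i | i : 'Z_p in predC1 0]].
split.
- move=> s _ /=; split; first split => /=.
  + by have [i ->] := gal_Dfield s; exists i.
  + exact: epsilon_sign.
  + by have [i i0 ->] := gal_zeta s; exists i; rewrite //= (Zp_unit_prime _ p_prime).
- by move=> s t; rewrite !inE; apply: f_inj.
move=> [[V e] z] [[[i _ /= <-] es] [j ju /= <-]].
have [] := inj_card_surj _ _ _ _ tgt f_inj _ _ (Dfield p c beta zeta i, e, zeta ^+ j).
- move=> s _; apply: allpairs_f; first apply: allpairs_f.
  + by have [k ->] := gal_Dfield s; apply/mapP; exists k; rewrite ?mem_enum.
  + by rewrite !inE; have [->|->] := epsilon_sign s; rewrite eqxx ?orbT.
  + by have [k k0 ->] := gal_zeta s; apply/mapP; exists k; rewrite ?mem_enum.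
- rewrite !size_allpairs size_Dfields size_prim_powers.
  by have := card_galK; rewrite dim_E nd mulnA.
- apply: allpairs_f; first apply: allpairs_f.
  + by apply/mapP; exists i; rewrite ?mem_enum.
  + by rewrite !inE; case: es => ->; rewrite eqxx ?orbT.
  + by apply/mapP; exists j; rewrite ?mem_enum ?inE -?(Zp_unit_prime _ p_prime).
by move=> s sG sE; exists s.
Qed.

Lemma set_bij_in_Fp : sqrtDelta \in <<1; zeta>>%VS ->
  set_bij [set` 'Gal(K / 1)%g]%classic
    (Dfamily p c beta zeta `*` primitive_powers p zeta)%classic
    (fun s : gal_of K => ((s @: Dfield p c beta zeta 0%R)%VS, s zeta)).
Proof.
move=> dF.
have f_inj : {in 'Gal(K / 1)%g &, injective (fun s : gal_of K =>
    ((s @: Dfield p c beta zeta 0%R)%VS, s zeta))}.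
  (* The sign component is redundant here: the image of [zeta] determines that of [sqrtDelta]. *)
  move=> s t _ _ [sD sz]; apply: gal_inj => //; exact: ahom_eq_adjoin sz dF.
pose tgt := [seq (V, z) | V <- [seq Dfield p c beta zeta i | i : 'Z_p],
  z <- [seq zeta ^+ i | i : 'Z_p in predC1 0]].
split.
- move=> s _ /=; split=> /=.
  + by have [i ->] := gal_Dfield s; exists i.
  + by have [i i0 ->] := gal_zeta s; exists i; rewrite //= (Zp_unit_prime _ p_prime).
- by move=> s t; rewrite !inE; apply: f_inj.
move=> [V z] [[i _ /= <-] [j ju /= <-]].
have [] := inj_card_surj _ _ _ _ tgt f_inj _ _ (Dfield p c beta zeta i, zeta ^+ j).
- move=> s _; apply: allpairs_f.
  + by have [k ->] := gal_Dfield s; apply/mapP; exists k; rewrite ?mem_enum.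
  + by have [k k0 ->] := gal_zeta s; apply/mapP; exists k; rewrite ?mem_enum.
- rewrite !size_allpairs size_Dfields size_prim_powers.
  by have := card_galK; rewrite dim_E dF mul1n.
- apply: allpairs_f; first by apply/mapP; exists i; rewrite ?mem_enum.
  by apply/mapP; exists j; rewrite ?mem_enum ?inE -?(Zp_unit_prime _ p_prime).
by move=> s sG sE; exists s.
Qed.

End DicksonGalois.

Theorem theorem4p6 (p : nat) (b c : rat)
    (L : splittingFieldType rat) (K : {subfield L})
    (sqrtDelta alpha beta zeta : L)
    (p_prime : prime p) (p_gt3 : (3 < p)%N)
    (h_irr : irreducible_poly (hpoly p b c))
    (sqrtDeltaP : sqrtDelta ^+ 2 = (Delta p b c)%:A)
    (alpha_root : root (map_poly (in_alg L) (alpha_poly p b c)) alpha)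
    (betaP : beta ^+ p = alpha)
    (zeta_prim : p.-primitive_root zeta)
    (K_split : splittingFieldFor 1 (map_poly (in_alg L) (hpoly p b c)) K) :
  let Fp := <<1; zeta>>%VS in
  let D := Dfield p c beta zeta in
  (sqrtDelta \notin Fp ->
     set_bij [set` 'Gal(K / 1)%g]%classic
       (Dfamily p c beta zeta `*` signs L `*` primitive_powers p zeta)%classic
       (fun sigma : gal_of K =>
          ((sigma @: D 0%R)%VS, epsilon sqrtDelta sigma, sigma zeta))) /\
  (sqrtDelta \in Fp ->
     set_bij [set` 'Gal(K / 1)%g]%classic
       (Dfamily p c beta zeta `*` primitive_powers p zeta)%classic
       (fun sigma : gal_of K => ((sigma @: D 0%R)%VS, sigma zeta))).
Proof.
split=> dF.
  exact: (set_bij_notin_Fp p b c L K sqrtDelta alpha beta zeta).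
exact: (set_bij_in_Fp p b c L K sqrtDelta alpha beta zeta).
Qed.
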